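(* Let $T$ be a locally finite geometric tree. Then the set of geodesics in $T$ with vertex endpoints is in one-to-one correspondence with the set of finite (nonempty) sequences of consecutively adjacent vertices of $T$ in which each vertex appears at most once. Further, let $v_1,\dots,v_n$ ($n\ge2$) be vertices in $T$ (not necessarily adjacent or distinct). Then $$\mathrm{im}(u_{v_1,v_n})\subseteq\bigcup_{i=1}^{n-1}\mathrm{im}(u_{v_i,v_{i+1}}).$$
   Context: A geometric tree is a contractible simplicial $1$-complex equipped with the canonical path metric in which each edge is isometric to the unit interval; it is locally finite if each vertex has finitely many edges attached. Two vertices are adjacent if they are joined by an edge. A geodesic from $x$ to $x'$ in a metric space is an isometric embedding $u_{x,x'}:[0,d(x,x')]\to X$ with $u_{x,x'}(0)=x$ and $u_{x,x'}(d(x,x'))=x'$. Locally finite geometric trees are uniquely geodesic: there is exactly one geodesic $u_{x,x'}$ between any two points. *)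

(* Defs.v *)
From HB Require Import structures.
From mathcomp Require Import all_boot all_order all_algebra.
From mathcomp Require Import boolp classical_sets functions cardinality reals.
From mathcomp Require Import interval_inference topology normedtype.

Set Implicit Arguments.
Unset Strict Implicit.
Unset Printing Implicit Defensive.

Import Order.TTheory GRing.Theory Num.Theory numFieldNormedType.Exports.

Local Open Scope classical_set_scope.
Local Open Scope ring_scope.

(* An abstract simplicial complex of dimension at most 1 amounts to a simple
   graph: its simplices are the singletons {a} and the pairs {a, b} with a
   adjacent to b. *)
Record complex1 := Complex1 {
  vert :> choiceType;
  adj : rel vert;
  adj_sym : symmetric adj;
  adj_irr : irreflexive adj }.

Definition simplex (K : complex1) (s : seq K) : bool :=
  match s with
  | [:: _] => true
  | [:: a; b] => adj a b
  | _ => false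
  end.

Definition locally_finite (K : complex1) : Prop :=
  forall a : K, finite_set [set b | adj a b].

Section Realization.
Variables (R : realType) (K : complex1).

(* Points of the geometric realization, in barycentric coordinates. *)
Record realization := RealizationPoint {
  coord :> K -> R;
  coordP : exists s : seq K, [/\ simplex s,
    forall a, 0 <= coord a,
    forall a, a \notin s -> coord a = 0
    & \sum_(a <- s) coord a = 1] }.

HB.instance Definition _ := gen_eqMixin realization.
HB.instance Definition _ := gen_choiceMixin realization.

Fact vertex_subproof (v : K) : exists s : seq K, [/\ simplex s,
  forall a, 0 <= (a == v)%:R :> R,
  forall a, a \notin s -> (a == v)%:R = 0 :> R
  & \sum_(a <- s) (a == v)%:R = 1 :> R].
Proof.
exists [:: v]; split=> // [a|].
  by rewrite inE => /negbTE ->.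
by rewrite big_seq1 eqxx.
Qed.

Definition vertex (v : K) : realization := RealizationPoint (vertex_subproof v).

Definition in_edge (a b : K) (x : realization) : Prop :=
  adj a b /\ forall c, c \notin [:: a; b] -> x c = 0.

(* The map x |-> x a identifies the closed edge {a, b} with [0, 1] (on it,
   x a + x b = 1); the topology on the realization is the coherent (weak) one:
   a set is open iff its trace on each closed edge is open. *)
Definition coherent_open (U : set realization) : Prop :=
  forall (a b : K) (x : realization), in_edge a b x -> U x ->
  exists2 e : R, 0 < e &
    forall y : realization, in_edge a b y -> `|x a - y a| < e -> U y.

Fact coherent_openT : coherent_open setT.
Proof. by move=> a b x _ _; exists 1. Qed.

Fact coherent_openI : setI_closed coherent_open.
Proof.
move=> U W oU oW a b x abx [Ux Wx].
have [e e0 He] := oU a b x abx Ux; have [f f0 Hf] := oW a b x abx Wx.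
exists (Num.min e f); first by rewrite lt_min e0.
by move=> y aby; rewrite lt_min => /andP[/He-/(_ aby) ? /Hf-/(_ aby) ?].
Qed.

Fact coherent_open_bigcup (I : Type) (f : I -> set realization) :
  (forall i, coherent_open (f i)) -> coherent_open (\bigcup_i f i).
Proof.
move=> of_ a b x abx [i _ fix_]; have [e e0 He] := of_ i a b x abx fix_.
by exists e => // y aby /He-/(_ aby) ?; exists i.
Qed.

HB.instance Definition _ := isOpenTopological.Build realization
  coherent_openT coherent_openI coherent_open_bigcup.

(* edge_chain x y l: there are points x = x_0, ..., x_k = y such that any two
   consecutive ones lie in a common closed edge, the lengths of the segments
   [x_i, x_(i+1)] adding up to l. *)
Inductive edge_chain : realization -> realization -> R -> Prop :=
| EdgeChainNil x : edge_chain x x 0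
| EdgeChainCons a b x y z l : in_edge a b x -> in_edge a b y ->
    edge_chain y z l -> edge_chain x z (`|x a - y a| + l).

(* The path metric in which the edges have length 1.  In a disconnected
   complex this is not a metric: inf set0 = 0. *)
Definition path_dist (x y : realization) : R := inf [set l | edge_chain x y l].

Lemma path_dist_ge0 x y : 0 <= path_dist x y.
Proof.
rewrite /path_dist; set A := [set l | _].
have [->|/set0P A0] := eqVneq A set0; first by rewrite inf0.
by apply: lb_le_inf => // l; elim=> // *; rewrite addr_ge0.
Qed.

Definition geo_dom (x y : realization) := {t : R | 0 <= t <= path_dist x y}.

Fact geo_src_subproof x y : 0 <= (0 : R) <= path_dist x y.
Proof. by rewrite lexx path_dist_ge0. Qed.

Fact geo_tgt_subproof x y : 0 <= path_dist x y <= path_dist x y.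
Proof. by rewrite lexx path_dist_ge0. Qed.

Definition geo_src x y : geo_dom x y := exist _ 0 (geo_src_subproof x y).
Definition geo_tgt x y : geo_dom x y :=
  exist _ (path_dist x y) (geo_tgt_subproof x y).

Record geodesic (x y : realization) := Geodesic {
  gmap :> geo_dom x y -> realization;
  gmap_isometry : forall s t : geo_dom x y,
    path_dist (gmap s) (gmap t) = `|val s - val t|;
  gmap_src : gmap (geo_src x y) = x;
  gmap_tgt : gmap (geo_tgt x y) = y }.

Definition im (x y : realization) (g : geodesic x y) : set realization :=
  g @` [set: geo_dom x y].

Record vertex_geodesic := VertexGeodesic {
  vg_src : K;
  vg_tgt : K;
  vg_geo :> geodesic (vertex vg_src) (vertex vg_tgt) }.

(* s lists the vertices lying on [g], in the order in which [g] visits them;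
   for a duplicate-free s this determines s. *)
Definition traverses (g : vertex_geodesic) (s : seq K) : Prop :=
  (forall v, v \in s <-> im g (vertex v)) /\
  (forall t t' v v', g t = vertex v -> g t' = vertex v' ->
     (val t <= val t') = (index v s <= index v' s)%N).

End Realization.

Definition simple_path (K : complex1) :=
  {s : seq K | [&& s != [::], sorted (@adj K) s & uniq s]}.

Definition contractible (R : realType) (X : topologicalType) : Prop :=
  exists (x0 : X) (H : X * R -> X),
    [/\ {within [set z : X * R | 0 <= z.2 <= 1], continuous H},
        forall x, H (x, 0) = x
      & forall x, H (x, 1) = x0].

Definition geometric_tree (R : realType) (K : complex1) : Prop :=
  contractible R (realization R K).

(* Main.v *)
Require Import Defs.
From HB Require Import structures.
From mathcomp Require Import all_boot all_order all_algebra.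
From mathcomp Require Import boolp classical_sets functions cardinality reals.
From mathcomp Require Import interval_inference topology normedtype.
From mathcomp Require Import lra zify.

Set Implicit Arguments.
Unset Strict Implicit.
Unset Printing Implicit Defensive.

Import Order.TTheory GRing.Theory Num.Theory numFieldNormedType.Exports.

Local Open Scope classical_set_scope.
Local Open Scope ring_scope.

(** Contractibility enters twice.  The points joined to a given vertex form a
    clopen set, so the graph is connected.  And every edge {a, b} is a bridge:
    collapsing everything else maps the realization to the circle R/Z, and
    lifting this map along the contraction, over a cycle through {a, b}, gives a
    real function that increases by 1 along {a, b} and is constant along the rest
    of the cycle.  Hence any two vertices are joined by a unique simple path.

    For a vertex v, let h_v be the affine extension of the combinatorial distance
    to v.  It is 1-Lipschitz, so a point x at time t on a geodesic from v to w
    satisfies h_v x <= t and h_w x <= d(v, w) - t; these two inequalities force x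
    to be the point of height t on the simple path from v to w.  The inclusion of
    images reduces to three vertices, where it says that an edge of the path from
    v to w lies on the path from v to z or on the path from z to w: otherwise it
    would not be a bridge. *)

(** * Lifting maps to the circle along a homotopy *)

Section Lifting.
Variable R : realType.

(** Connectedness of the unit interval. [P] holds at the supremum of the points where it holds; from
    there it spreads either to 1 or to a point beyond the supremum, which is absurd. *)
Lemma locally_constant_segment (P : R -> Prop) :
  (forall t, 0 <= t <= 1 -> exists2 e, 0 < e &
     forall s, 0 <= s <= 1 -> `|t - s| < e -> (P t <-> P s)) ->
  P 0 -> P 1.
Proof.
move=> lP P0.
pose S := [set t : R | 0 <= t <= 1 /\ P t].
have S0 : S 0 by split=> //; lra.
have ubS : has_ubound S by exists 1 => t [/andP[_ ]].
have supS : has_sup S by split=> //; exists 0.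
have c0 : 0 <= sup S by exact: ub_le_sup.
have c1 : sup S <= 1 by apply: ge_sup => // [|t [/andP[_ ]] //]; exists 0.
have c01 : 0 <= sup S <= 1 by rewrite c0.
have [e e0 eP] := lP _ c01.
have [t [t01 Pt] ct] := sup_adherent e0 supS.
have tc : t <= sup S by exact: ub_le_sup.
have Pc : P (sup S) by apply/(eP t) => //; rewrite ltr_norml; lra.
have [le1|lt1] := lerP 1 (sup S + e / 2).
  by apply/(eP 1) => //; [lra|rewrite ltr_norml; lra].
have : S (sup S + e / 2).
  by split; [lra|apply/(eP (sup S + e / 2)) => //; [lra|rewrite ltr_norml; lra]].
by move=> /(ub_le_sup ubS); lra.
Qed.

(** The class of [r] is within [e] of 0 in the circle R/Z. *)
Definition near_int (e r : R) : Prop := exists k : int, `|r - k%:~R| < e.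

Lemma near_intN e r : near_int e r -> near_int e (- r).
Proof. by case=> k rk; exists (- k); rewrite intrN -opprD normrN. Qed.

Lemma near_intD e f r s : near_int e r -> near_int f s -> near_int (e + f) (r + s).
Proof.
case=> k rk [l sl]; exists (k + l); rewrite intrD.
have -> : r + s - (k%:~R + l%:~R) = (r - k%:~R) + (s - l%:~R) by lra.
by apply: le_lt_trans (ler_normD _ _) _; rewrite ltrD.
Qed.

Lemma int_norm_lt1 (k : int) : `|k%:~R : R| < 1 -> k = 0.
Proof. by rewrite -intr_norm -[1]/(1%:~R) ltr_int; lia. Qed.

Lemma near_int_small e r : near_int e r -> `|r| < 1 - e -> `|r| < e.
Proof.
case=> k rk r1; suff k0 : k = 0 by move: rk; rewrite k0 subr0.
by apply: int_norm_lt1; move: rk r1; rewrite !ltr_norml; lra.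
Qed.

(* [g] is read modulo 1, as a map to the circle R/Z. *)
Definition circle_continuous (X : topologicalType) (K : set X) (g : X -> R) :=
  forall x, K x -> forall e : R, 0 < e ->
    \forall y \near x, K y -> near_int e (g y - g x).

Definition circle_lift (X : topologicalType) (K : set X) (g F : X -> R) : Prop :=
  (forall x, K x -> exists k : int, F x - g x = k%:~R) /\
  (forall x, K x -> forall e : R, 0 < e ->
     \forall y \near x, K y -> `|F y - F x| < e).

(** Add to [F] the representative of [h - g] modulo 1 of absolute value below 1/4. *)
Lemma lift_perturb (X : topologicalType) (K : set X) (g h F : X -> R) :
  circle_continuous K h -> (forall x, K x -> near_int (1 / 4) (h x - g x)) ->
  circle_lift K g F -> exists G, circle_lift K h G.
Proof.
move=> ch gh [Fg cF].
have /choice[k kP] : forall x, exists k : int, K x -> `|h x - g x - k%:~R| < 1 / 4.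
  move=> x; have [Kx|nKx] := pselect (K x); last by exists 0.
  by have [k] := gh _ Kx; exists k.
exists (fun x => F x + (h x - g x - (k x)%:~R)); split=> [x Kx|x Kx e e0].
  have [l Fl] := Fg _ Kx; exists (l - k x); rewrite intrB -Fl; lra.
(* With [d <= 1 / 4], increments of the new function are below 1/4 + 1/4 + 1/4 <= 1 - [d], as
   [near_int_small] requires. *)
have [d [d0 de d4]] : exists d : R, [/\ 0 < d, d <= e & d <= 1 / 4].
  by exists (Num.min e (1 / 4)); rewrite lt_min !ge_min e0 !lexx orbT; split=> //; lra.
have := cF _ Kx _ d0; have := ch _ Kx _ d0.
apply: filterS2 => y hy Fy Ky.
have {}hy := hy Ky; have {}Fy := Fy Ky.
apply: lt_le_trans de; apply: near_int_small; last first.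
  by have := kP _ Ky; have := kP _ Kx; move: Fy; rewrite !ltr_norml; lra.
have [m hm] := hy; have [p Fp] := Fg _ Kx; have [q Fq] := Fg _ Ky.
exists (m + q - p - k y + k x); move: hm; rewrite !(intrD, intrB, intrN) -Fp -Fq.
by apply: le_lt_trans; rewrite le_eqVlt; apply/orP; left; apply/eqP; congr `|_|; lra.
Qed.

(** Liftability at time [t] is locally constant in [t]: by compactness of [K], the maps at close
    times are uniformly within 1/4 modulo 1, and [lift_perturb] applies in both directions. *)
Lemma homotopy_lift (X : topologicalType) (K : set X) (G : X * R -> R) :
  compact K ->
  (forall (x : X) (t : R), K x -> 0 <= t <= 1 -> forall e : R, 0 < e ->
     \forall z \near (x, t), K z.1 -> 0 <= z.2 <= 1 ->
       near_int e (G z - G (x, t))) ->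
  (exists F, circle_lift K (fun x => G (x, 1)) F) ->
  exists F, circle_lift K (fun x => G (x, 0)) F.
Proof.
move=> /compact_near_coveringP cK cG.
have cGt (t : R) : 0 <= t <= 1 -> circle_continuous K (fun x => G (x, t)).
  move=> t01 x Kx e e0; have [[A B] /= [nA nB] AB] := cG _ _ Kx t01 _ e0.
  apply: filterS nA => y Ay Ky; apply: (AB (y, t)) => //=; split=> //=.
  exact: nbhs_singleton.
(* The lift is known at time 1 and wanted at time 0, while [locally_constant_segment] goes from 0 to
   1; so it is applied to the absence of a lift. *)
suff H : (~ exists F, circle_lift K (fun x => G (x, 0)) F) ->
    (~ exists F, circle_lift K (fun x => G (x, 1)) F).
  by move=> F1; apply: contrapT => /H; apply.
apply: (@locally_constant_segment
  (fun t => ~ exists F, circle_lift K (fun x => G (x, t)) F)) => t t01.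
have : \forall s \near t, K `<=` (fun x => K x -> 0 <= s <= 1 ->
    near_int (1 / 4) (G (x, s) - G (x, t))).
  apply: (cK R (nbhs t) (fun s x => K x -> 0 <= s <= 1 ->
    near_int (1 / 4) (G (x, s) - G (x, t)))) => x Kx.
  have e0 : 0 < 1 / 8 :> R by lra.
  have [[A B] /= [nA nB] AB] := cG _ _ Kx t01 _ e0.
  exists (A, B) => // -[y s] /= [Ay Bs] Ky s01.
  (* Both values are compared with [G (x, t)], each costing 1/8. *)
  have -> : G (y, s) - G (y, t) = (G (y, s) - G (x, t)) + - (G (y, t) - G (x, t)).
    lra.
  have -> : 1 / 4 = 1 / 8 + 1 / 8 :> R by lra.
  apply: near_intD; first by apply: (AB (y, s)).
  by apply/near_intN/(AB (y, t)) => //; split=> //; exact: nbhs_singleton.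
move=> /nbhs_ballP[e /= e0 eP]; exists e => // s s01 ts.
have near x : K x -> near_int (1 / 4) (G (x, s) - G (x, t)).
  by move=> Kx; apply: (eP s).
by split; apply: contra_not => -[F];
  apply: lift_perturb; [exact: cGt| |exact: cGt|] => // x /near // /near_intN;
  rewrite opprB.
Qed.

End Lifting.

(** * The geometric realization *)

Lemma sum_support (I : eqType) (V : nmodType) (F : I -> V) (s s' : seq I) :
  uniq s -> uniq s' -> (forall c, c \notin s -> F c = 0) ->
  (forall c, c \notin s' -> F c = 0) ->
  \sum_(c <- s) F c = \sum_(c <- s') F c.
Proof.
move=> us us' Fs Fs'.
have rmz r : \sum_(c <- r) F c = \sum_(c <- [seq c <- r | F c != 0]) F c.
  by rewrite big_filter [RHS]big_mkcond; apply: eq_bigr => c _; case: eqP.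
rewrite rmz [RHS]rmz; apply: perm_big; apply: uniq_perm; rewrite ?filter_uniq//.
move=> c; rewrite !mem_filter; case: eqP => //= Fc.
have -> : c \in s by apply: contraT => /Fs.
by apply/esym; apply: contraT => /Fs'.
Qed.

Section RealizationTheory.
Variables (R : realType) (K : complex1).
Local Notation X := (realization R K).
Implicit Types (x y : X) (a b c d : K).

Lemma adj_neq a b : adj a b -> a != b.
Proof. by apply: contraTneq => ->; rewrite adj_irr. Qed.

Lemma simplex_uniq (s : seq K) : simplex s -> uniq s.
Proof. by case: s => [|a [|b []]] //= /adj_neq ab; rewrite inE ab. Qed.

Lemma coord_ge0 x a : 0 <= x a.
Proof. by have [s []] := coordP x. Qed.

Lemma realization_eq x y : (forall c, x c = y c) -> x = y.
Proof.
case: x y => [f fP] [g gP] /= /funext fg.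
by move: fP; rewrite fg => fP; congr RealizationPoint; exact: Prop_irrelevance.
Qed.

Lemma in_edge_sum a b x : in_edge a b x -> x a + x b = 1.
Proof.
case=> ab xab; have [s [ss _ xs <-]] := coordP x.
have := @sum_support _ _ (Defs.coord x) s [:: a; b] (simplex_uniq ss).
by rewrite /= inE adj_neq//= big_cons big_seq1 => ->.
Qed.

Lemma in_edge_sym a b x : in_edge a b x -> in_edge b a x.
Proof.
case=> ab xab; split=> [|c cba]; first by rewrite adj_sym.
by apply: xab; move: cba; rewrite !inE orbC.
Qed.

Lemma in_edge_bounds a b x : in_edge a b x -> 0 <= x a <= 1.
Proof. by move=> /in_edge_sum; have := coord_ge0 x a; have := coord_ge0 x b; lra. Qed.

(** The first case is there for isolated vertices, which lie on no closed edge. *)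
Lemma realization_cases x :
  (exists c, x = vertex R c) \/ exists a b, in_edge a b x.
Proof.
have [s [ss _ xs]] := coordP x; case: s ss xs => [|a [|b []]] //= ab xs.
  rewrite big_seq1 => xa; left; exists a; apply: realization_eq => c /=.
  by have [->//|ca] := eqVneq c a; rewrite xs// inE.
by right; exists a, b.
Qed.

Lemma vertex_in_edge a b : adj a b -> in_edge a b (vertex R a).
Proof. by split=> // c; rewrite !inE negb_or => /andP[/negbTE /= ->]. Qed.

Lemma in_edge_vertex a b x : in_edge a b x -> x a = 1 -> x = vertex R a.
Proof.
move=> abx xa; apply: realization_eq => c /=.
have [->//|ca] := eqVneq c a; have [->|cb] := eqVneq c b => /=.
  by have := in_edge_sum abx; rewrite xa mulr0n; lra.
by apply: abx.2; rewrite !inE (negbTE ca) (negbTE cb).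
Qed.

Lemma nbhs_in_edge a b x (U : set X) : in_edge a b x -> nbhs x U ->
  exists2 e : R, 0 < e & forall y, in_edge a b y -> `|x a - y a| < e -> U y.
Proof.
move=> abx; rewrite nbhsE => -[V [oV Vx] VU].
by have [e e0 eP] := oV a b x abx Vx; exists e => // y aby /eP-/(_ aby)/VU.
Qed.

Lemma coherent_open_nbhs x (U : set X) : coherent_open U -> U x -> nbhs x U.
Proof. by move=> oU Ux; apply: open_nbhs_nbhs; split. Qed.

(** Makes the parametrization of an edge total on the reals while keeping it continuous. *)
Definition clamp (t : R) : R := if t <= 0 then 0 else if t <= 1 then t else 1.

Lemma clampP t : 0 <= clamp t <= 1.
Proof. by rewrite /clamp; case: (lerP t 0) => t0; case: (lerP t 1) => t1; lra. Qed.

Lemma clamp_id t : 0 <= t <= 1 -> clamp t = t.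
Proof. by rewrite /clamp; case: (lerP t 0) => t0; case: (lerP t 1) => t1; lra. Qed.

Lemma clamp_lip s t : `|clamp s - clamp t| <= `|s - t|.
Proof.
have := ler_norm (s - t); have := lerNnormlW (lexx `|s - t|).
rewrite /clamp ler_norml; move: `|s - t| => n.
by case: (lerP s 0) => s0; case: (lerP s 1) => s1; case: (lerP t 0) => t0;
  case: (lerP t 1) => t1; lra.
Qed.

(** * Parametrization and compactness of closed edges *)

Section EdgePoint.
Variables (a b : K).
Hypothesis ab : adj a b.

Definition edge_coord (t : R) (c : K) : R :=
  (c == a)%:R * (1 - clamp t) + (c == b)%:R * clamp t.

Fact edge_point_subproof t : exists s : seq K, [/\ simplex s,
  forall c, 0 <= edge_coord t c,
  forall c, c \notin s -> edge_coord t c = 0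
  & \sum_(c <- s) edge_coord t c = 1].
Proof.
have t01 := clampP t; rewrite /edge_coord; exists [:: a; b]; split=> //.
- by move=> c; rewrite addr_ge0// mulr_ge0//; lra.
- by move=> c; rewrite !inE negb_or => /andP[/negbTE-> /negbTE->]; rewrite mulr0n; lra.
- rewrite big_cons big_seq1 !eqxx [b == a]eq_sym (negbTE (adj_neq ab)) mulr0n mulr1n; lra.
Qed.

Definition edge_point t : X := RealizationPoint (edge_point_subproof t).

Lemma edge_point_in t : in_edge a b (edge_point t).
Proof.
split=> // c; rewrite !inE negb_or => /andP[/negbTE ca /negbTE cb].
by rewrite /= /edge_coord ca cb mulr0n; lra.
Qed.

Lemma edge_point_src t : edge_point t a = 1 - clamp t.
Proof. by rewrite /= /edge_coord eqxx (negbTE (adj_neq ab)) mulr0n mulr1n; lra. Qed.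

Lemma edge_point_tgt t : edge_point t b = clamp t.
Proof. by rewrite /= /edge_coord eqxx eq_sym (negbTE (adj_neq ab)) mulr0n mulr1n; lra. Qed.

Lemma edge_point0 : edge_point 0 = vertex R a.
Proof.
apply: (in_edge_vertex (edge_point_in 0)).
by rewrite edge_point_src clamp_id; lra.
Qed.

Lemma edge_point1 : edge_point 1 = vertex R b.
Proof.
apply: (in_edge_vertex (in_edge_sym (edge_point_in 1))).
by rewrite edge_point_tgt clamp_id; lra.
Qed.

Lemma nbhs_edge_point t (U : set X) : nbhs (edge_point t) U ->
  exists2 e : R, 0 < e & forall s, `|t - s| < e -> U (edge_point s).
Proof.
move=> /(nbhs_in_edge (edge_point_in t))[e e0 eP]; exists e => // s ts.
apply: eP; first exact: edge_point_in.
rewrite !edge_point_src; apply: le_lt_trans ts.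
have -> : 1 - clamp t - (1 - clamp s) = - (clamp t - clamp s) by lra.
by rewrite normrN clamp_lip.
Qed.

Lemma edge_point_continuous : continuous edge_point.
Proof.
by move=> t U /nbhs_edge_point[e e0 eP]; apply/nbhs_ballP; exists e.
Qed.

Lemma in_edge_point x : in_edge a b x -> x = edge_point (x b).
Proof.
move=> abx; have xb := in_edge_bounds (in_edge_sym abx).
apply: realization_eq => c /=; rewrite /edge_coord clamp_id//.
have [->|ca] := eqVneq c a.
  by have := in_edge_sum abx; rewrite (negbTE (adj_neq ab)) mulr0n mulr1n; lra.
have [->|cb] := eqVneq c b; first by rewrite mulr0n mulr1n; lra.
by rewrite abx.2 ?inE ?(negbTE ca) ?(negbTE cb)// mulr0n; lra.
Qed.

End EdgePoint.

Lemma compact_in_edge a b : compact (in_edge a b : set X).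
Proof.
have [ab|nab] := boolP (adj a b); last first.
  suff -> : (in_edge a b : set X) = set0 by exact: compact0.
  by apply/seteqP; split=> // x [ab]; rewrite ab in nab.
suff -> : (in_edge a b : set X) = edge_point ab @` `[0, 1].
  apply: continuous_compact; last exact: segment_compact.
  exact/continuous_subspaceT/edge_point_continuous.
apply/seteqP; split=> [x abx|_ [t _ <-]]; last exact: edge_point_in.
exists (x b); first by rewrite /= in_itv /= (in_edge_bounds (in_edge_sym abx)).
by rewrite -in_edge_point.
Qed.

Definition edges_set (L : seq (K * K)) : set X :=
  [set x | exists2 e, e \in L & in_edge e.1 e.2 x].

Lemma compact_edges_set (L : seq (K * K)) : compact (edges_set L).
Proof.
elim: L => [|e L IH].
  suff -> : edges_set [::] = set0 by exact: compact0.
  by apply/seteqP; split=> // x [].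
suff -> : edges_set (e :: L) = in_edge e.1 e.2 `|` edges_set L.
  by apply: compactU => //; exact: compact_in_edge.
apply/seteqP; split=> [x [f]|x [ex|[f fL fx]]].
- by rewrite inE => /predU1P[-> ?|fL fx]; [left|right; exists f].
- by exists e; rewrite ?mem_head.
- by exists f => //; rewrite inE fL orbT.
Qed.

End RealizationTheory.

(** * Contractible graphs are trees *)

Section Contractible.
Variables (R : realType) (K : complex1).
Local Notation X := (realization R K).
Implicit Types (x y : X) (a b c d : K).

(** * Connectedness of the graph *)

Definition reachable (e : rel K) a b := exists2 p, path e a p & last a p = b.

Lemma reachable_refl e a : reachable e a a.
Proof. by exists [::]. Qed.

Lemma reachable_trans e a b c : reachable e a b -> reachable e b c -> reachable e a c.
Proof.
by case=> p ep <- [q eq <-]; exists (p ++ q); rewrite ?cat_path ?ep ?last_cat.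
Qed.

Lemma reachable_step (e : rel K) a b : e a b -> reachable e a b.
Proof. by move=> ab; exists [:: b]; rewrite /= ?ab. Qed.

Lemma reachable_sym e a b : symmetric e -> reachable e a b -> reachable e b a.
Proof.
move=> se [p]; elim: p a => [|c p IH] a /=; first by move=> _ ->; exact: reachable_refl.
move=> /andP[ac cp] lp; apply: reachable_trans (IH _ cp lp) _.
by apply: reachable_step; rewrite se.
Qed.

Lemma within_continuous_near (Y Z : topologicalType) (A : set Y) (f : Y -> Z) (y : Y)
    (W : set Z) : {within A, continuous f} -> A y -> nbhs (f y) W ->
  \forall z \near y, A z -> W (f z).
Proof.
by move=> cf Ay nW; have := cf y W nW; rewrite /nbhs /= -nbhs_subspace_in.
Qed.

(** The track of [x] under the homotopy is a path, so it cannot leave a clopen set. *)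
Lemma homotopy_locally_constant (Y : topologicalType) (H : Y * R -> X) (x : Y)
    (S : set X) :
  {within [set z : Y * R | 0 <= z.2 <= 1], continuous H} ->
  coherent_open S -> coherent_open (~` S) -> S (H (x, 0)) -> S (H (x, 1)).
Proof.
move=> cH oS oC.
apply: (@locally_constant_segment R (fun t => S (H (x, t)))) => t t01.
have loc (U : set X) : coherent_open U -> U (H (x, t)) ->
    exists2 e : R, 0 < e & forall s, 0 <= s <= 1 -> `|t - s| < e -> U (H (x, s)).
  move=> oU Ut; have := within_continuous_near (y := (x, t)) cH t01
    (coherent_open_nbhs oU Ut).
  move=> [[A B] /= [nA /nbhs_ballP[e e0 eB]] AB]; exists e => // s s01 ts.
  by apply: (AB (x, s)) => //=; split=> /=; [exact: nbhs_singleton|exact: eB].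
have [St|nSt] := pselect (S (H (x, t))).
  by have [e e0 eP] := loc _ oS St; exists e => // s s01 ts; split=> // _; exact: eP.
by have [e e0 eP] := loc _ oC nSt; exists e => // s s01 /(eP _ s01) nSs; split.
Qed.

Lemma contractible_reachable : contractible R X ->
  forall v w : K, reachable (@adj K) v w.
Proof.
case=> x0 [H [cH H0 H1]] v w.
pose S u : set X := [set x | exists2 c, 0 < x c & reachable (@adj K) u c].
(* [S u] contains all or none of each closed edge, so any radius, here 1, shows that [S u] and its
   complement are open. *)
have S_edge u a b x y : in_edge a b x -> in_edge a b y -> S u x -> S u y.
  move=> abx aby [c xc uc].
  have [d yd cd] : exists2 d, 0 < y d & reachable (@adj K) c d.
    have [ya|ya] := boolP (0 < y a); last first.
      exists b; first by have := in_edge_sum aby; have := coord_ge0 y a;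
        have := coord_ge0 y b; lra.
      have [->|ca] := eqVneq c a; first by apply: reachable_step; case: abx.
      have [->|cb] := eqVneq c b; first exact: reachable_refl.
      by move: xc; rewrite abx.2 ?ltxx// !inE negb_or ca.
    exists a => //.
    have [->|ca] := eqVneq c a; first exact: reachable_refl.
    have [->|cb] := eqVneq c b; first by apply: reachable_step; rewrite adj_sym abx.1.
    by move: xc; rewrite abx.2 ?ltxx// !inE negb_or ca.
  by exists d => //; exact: reachable_trans cd.
have oS u : coherent_open (S u).
  by move=> a b x abx Sx; exists 1 => // y aby _; exact: S_edge abx aby Sx.
have oC u : coherent_open (~` S u).
  move=> a b x abx Sx; exists 1 => // y aby _ Sy; apply: Sx; exact: S_edge aby abx Sy.
have S0 : S v x0.
  rewrite -(H1 (vertex R v)); apply: homotopy_locally_constant => //.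
  by rewrite H0; exists v; rewrite /= ?eqxx//; exact: reachable_refl.
(* If [vertex R w] were outside [S v], its track would stay outside, yet it ends at [x0]. *)
have /contrapT : ~ ~ S v (vertex R w).
  move=> /= nS; have : (~` S v) (H (vertex R w, 1)).
    by apply: homotopy_locally_constant; rewrite ?setCK// H0.
  by rewrite H1.
by case=> c /=; case: eqP => [->//|_]; rewrite ltxx.
Qed.

(** Along the edge, [F] minus [sigma] times the parameter is continuous and varies by integers only,
    hence is constant. *)
Lemma edge_lift (A : set X) (g F : X -> R) (sigma : R) c d :
  adj c d -> in_edge c d `<=` A -> `|sigma| <= 1 ->
  (forall x, in_edge c d x -> exists k : int, g x - sigma * x d = k%:~R) ->
  circle_lift A g F -> F (vertex R d) - F (vertex R c) = sigma.
Proof.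
move=> cd cdA s1 gs [Fg cF].
suff : F (edge_point cd 1) - sigma * 1 = F (edge_point cd 0).
  by rewrite edge_point0 edge_point1; lra.
apply: (@locally_constant_segment R
  (fun t => F (edge_point cd t) - sigma * t = F (edge_point cd 0))); last by lra.
move=> t t01.
have inA s : A (edge_point cd s) by exact/cdA/edge_point_in.
have half : 0 < 1 / 2 :> R by lra.
have /nbhs_edge_point[e e0 eP] := cF _ (inA t) _ half.
exists (Num.min e (1 / 2)); first by rewrite lt_min e0.
move=> s s01; rewrite lt_min => /andP[/eP/(_ (inA s)) Fst ts].
suff -> : F (edge_point cd t) - sigma * t = F (edge_point cd s) - sigma * s by [].
have [k Ek] : exists k : int, F (edge_point cd s) - sigma * s -
    (F (edge_point cd t) - sigma * t) = k%:~R.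
  have [k1 E1] := Fg _ (inA s); have [k2 E2] := Fg _ (inA t).
  have [k3 E3] := gs _ (edge_point_in cd s).
  have [k4 E4] := gs _ (edge_point_in cd t).
  move: E3 E4; rewrite !edge_point_tgt !clamp_id// => E3 E4.
  by exists (k1 + k3 - (k2 + k4)); rewrite intrB !intrD; lra.
suff k0 : k = 0 by move: Ek; rewrite k0; lra.
apply: (@int_norm_lt1 R); rewrite -Ek.
have st : `|sigma * (s - t)| < 1 / 2.
  rewrite normrM distrC; apply: le_lt_trans ts.
  by rewrite ler_piMl.
by move: st Fst; rewrite !ltr_norml mulrBr; lra.
Qed.

(** * Every edge is a bridge *)

Section Bridge.
Variables a b : K.
Hypothesis ab : adj a b.

Definition avoid : rel K := fun c d =>
  adj c d && ~~ ((c == a) && (d == b) || (c == b) && (d == a)).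

(* Collapsing everything but the edge {a, b} gives a map to the circle R/Z. *)
Definition collapse (x : X) : R := if 0 < x a then x b else 0.

(** The derivative of [collapse], read modulo 1, along the edge oriented from [c] to [d]. *)
Definition slope c d : R :=
  if (c == a) && (d == b) then 1 else if (c == b) && (d == a) then - 1 else 0.

Lemma slope_le1 c d : `|slope c d| <= 1.
Proof.
rewrite /slope; case: ifP => _; first by rewrite normr1.
by case: ifP => _; rewrite ?normrN ?normr1 ?normr0.
Qed.

(** The integer absorbs the jump at [b], where [collapse] is 0 although it tends to 1 along {a, b}.
    Any other edge through [a] misses [b], so [collapse] vanishes on it. *)
Lemma collapse_edge c d x : in_edge c d x ->
  exists k : int, collapse x - slope c d * x d = k%:~R.
Proof.
move=> cdx; have xcd := in_edge_sum cdx.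
rewrite /slope; case: ifPn => [/andP[/eqP ca /eqP db]|n1].
  rewrite ca db in xcd; rewrite db /collapse; case: ltP => xa; [exists 0|exists (- 1)].
    by lra.
  by have := coord_ge0 x a; rewrite intrN; lra.
case: ifPn => [/andP[/eqP cb /eqP da]|n2].
  rewrite cb da in xcd; rewrite da /collapse; case: ltP => xa; [exists 1|exists 0].
    by lra.
  by have := coord_ge0 x a; lra.
rewrite /collapse; exists 0; case: ltP => xa; last by lra.
suff -> : x b = 0 by lra.
apply: cdx.2; apply/negP; rewrite !inE => bcd.
have acd : a \in [:: c; d] by apply: contraLR xa => /cdx.2 ->; rewrite ltxx.
have /negbTE ba := adj_neq ab.
move: bcd acd n1 n2; rewrite !inE ![c == _]eq_sym ![d == _]eq_sym.
by case/orP=> /eqP be; case/orP=> /eqP ae; move: ba; rewrite be ae ?eqxx //= orbT.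
Qed.

(** The coherent topology lets continuity be checked on each closed edge, where [collapse] is affine
    modulo 1 with slope at most 1; the radius is the slack left at [y]. *)
Lemma collapse_continuous x e : 0 < e ->
  \forall y \near x, near_int e (collapse y - collapse x).
Proof.
move=> e0; apply: coherent_open_nbhs; last by exists 0; rewrite /= subr0 subrr normr0.
move=> c d y cdy [k yk]; exists (e - `|collapse y - collapse x - k%:~R|).
  by rewrite subr_gt0.
move=> z cdz yz; have [ky Ey] := collapse_edge cdy; have [kz Ez] := collapse_edge cdz.
exists (k + kz - ky); rewrite intrB intrD -Ey -Ez.
have -> : collapse z - collapse x - (k%:~R + (collapse z - slope c d * z d) -
    (collapse y - slope c d * y d)) =
    (collapse y - collapse x - k%:~R) + slope c d * (z d - y d) by lra.
apply: le_lt_trans (ler_normD _ _) _; rewrite -ltrBrDl; apply: le_lt_trans yz.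
have -> : y c - z c = z d - y d.
  by have := in_edge_sum cdy; have := in_edge_sum cdz; lra.
by rewrite normrM ler_piMl// slope_le1.
Qed.

Lemma contractible_bridge : contractible R X -> ~ reachable avoid b a.
Proof.
case=> x0 [H [cH H0 H1]] [p bp lp].
(* The cycle: the edge from [a] to [b], then the steps of the path back to [a], each vertex being
   paired with its successor. *)
pose L := (a, b) :: zip (b :: p) p.
have [F Flift] : exists F,
    circle_lift (@edges_set R K L) (fun x => collapse (H (x, 0))) F.
  apply: (@homotopy_lift R X (@edges_set R K L) (collapse \o H)).
  - exact: compact_edges_set.
  - move=> x t _ t01 e e0.
    have := within_continuous_near (y := (x, t)) cH t01
      (collapse_continuous (H (x, t)) e0).
    by apply: filterS => z Hz _ /Hz.
  (* At time 1 the homotopy is constant, so a constant function is a lift. *)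
  - exists (fun=> collapse x0); split=> [x _|x _ e e0].
      by exists 0; rewrite /= H1 subrr.
    by apply: filterE => y _; rewrite subrr normr0.
have stepF c d : adj c d -> (c, d) \in L ->
    F (vertex R d) - F (vertex R c) = slope c d.
  move=> cd cdL; apply: (edge_lift cd _ (slope_le1 c d) _ Flift).
  - by move=> x cdx; exists (c, d).
  - by move=> x cdx; rewrite /= H0; exact: collapse_edge.
have pathF q c : path avoid c q -> {subset zip (c :: q) q <= L} ->
    F (vertex R (last c q)) = F (vertex R c).
  elim: q c => [//|d q IH] c /= /andP[/andP[cd ncd] dq] qL.
  rewrite IH//; last by move=> z zq; apply: qL; rewrite inE zq orbT.
  have := stepF c d cd (qL _ (mem_head _ _)); rewrite /slope.
  by move: ncd; rewrite negb_or => /andP[/negbTE-> /negbTE->]; lra.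
have : F (vertex R a) = F (vertex R b).
  by rewrite -{1}lp; apply: pathF => // z zL; rewrite inE zL orbT.
have := stepF a b ab (mem_head _ _); rewrite /slope !eqxx /=; lra.
Qed.

End Bridge.
End Contractible.

(** * Paths and geodesics in a tree *)

Section TreePaths.
Variable K : complex1.
Implicit Types (a b c v w z : K) (p q : seq K).
Hypothesis conn : forall v w, reachable (@adj K) v w.
Hypothesis bridge : forall a b, adj a b -> ~ reachable (avoid a b) b a.

Lemma avoid_sym a b : symmetric (avoid a b).
Proof.
by move=> c d; rewrite /avoid adj_sym orbC ![(d == _) && _]andbC.
Qed.

Lemma path_avoid a b v p : path (@adj K) v p ->
  ~~ ((a \in v :: p) && (b \in v :: p)) -> path (avoid a b) v p.
Proof.
move=> vp nab; apply: (@sub_in_path _ (mem (v :: p)) (@adj K)) => //; last first.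
  exact/allP.
move=> c d cp dp cd; rewrite /avoid cd /=; apply: contra nab.
by case/orP=> /andP[/eqP <- /eqP <-]; rewrite cp dp.
Qed.

(** If the first steps, to [x] and to [y], differ, following [p] to the common end and then [y :: q]
    backwards joins [x] to [v] without the bridge {v, x}. *)
Lemma simple_path_unique v p q : path (@adj K) v p -> path (@adj K) v q ->
  uniq (v :: p) -> uniq (v :: q) -> last v p = last v q -> p = q.
Proof.
elim: p v q => [|x p IH] v [|y q] //.
- by move=> _ _ _ /= /andP[vq _] E; rewrite E mem_last in vq.
- by move=> _ _ /= /andP[vp _] _ E; rewrite -E mem_last in vp.
move=> /= /andP[vx xp] /andP[vy yq] /andP[vNp up] /andP[vNq uq] E.
have [xy|xy] := eqVneq x y; first by subst y; rewrite (IH x q).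
case: (bridge vx); apply: (@reachable_trans _ _ _ (last x p)).
  by exists p => //; apply: path_avoid => //; rewrite (negbTE vNp).
apply: reachable_sym; first exact: avoid_sym.
(* The first step leads to [y], not [x], and [q] never returns to [v]. *)
exists (y :: q) => //=; rewrite {1}/avoid vy /= negb_or eqxx /= eq_sym xy /=.
rewrite path_avoid ?(negbTE vNq)// andbT negb_and; apply/orP; left.
by apply: adj_neq.
Qed.

(* The vertices of the simple path from [v] to [w], without its origin [v]. *)
Definition tree_path v w : seq K :=
  xget [::] [set p | [/\ path (@adj K) v p, last v p = w & uniq (v :: p)]].

(** Connectedness gives a walk and [shortenP] a simple one, so the default of [xget] is never
    taken. *)
Lemma tree_pathP v w : [/\ path (@adj K) v (tree_path v w),
  last v (tree_path v w) = w & uniq (v :: tree_path v w)].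
Proof.
rewrite /tree_path; set P := [set p | _]; suff : P (xget [::] P) by [].
apply: xgetPex; have [p vp] := conn v w.
by case/shortenP: vp => q vq uq _ qw; exists q.
Qed.

Lemma tree_path_eq v w p : path (@adj K) v p -> last v p = w -> uniq (v :: p) ->
  p = tree_path v w.
Proof.
have [vt tw ut] := tree_pathP v w => vp pw up.
by apply: (@simple_path_unique v) => //; rewrite tw.
Qed.

(** As [tree_path] omits its origin, its size counts edges. *)
Definition gdist v w : nat := size (tree_path v w).

Lemma gdist_le v w p : path (@adj K) v p -> last v p = w -> (gdist v w <= size p)%N.
Proof.
case/shortenP=> q vq uq qp qw; rewrite /gdist -(tree_path_eq vq qw uq).
by apply: uniq_leq_size => //; case/andP: uq.
Qed.

Lemma gdistxx v : gdist v v = 0%N.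
Proof. by apply/eqP; rewrite -leqn0; exact: (@gdist_le v v [::]). Qed.

Lemma gdist_adj_le1 v w : adj v w -> (gdist v w <= 1)%N.
Proof. by move=> vw; apply: (@gdist_le v w [:: w]); rewrite /= ?vw. Qed.

Lemma gdist_triangle c v w : (gdist v w <= gdist v c + gdist c w)%N.
Proof.
have [vc cv _] := tree_pathP v c; have [cw wc _] := tree_pathP c w.
by rewrite -size_cat; apply: gdist_le; rewrite ?cat_path ?last_cat cv ?vc.
Qed.

Lemma gdist_sym v w : gdist v w = gdist w v.
Proof.
suff le u x : (gdist u x <= gdist x u)%N by apply/eqP; rewrite eqn_leq !le.
have [xp pu _] := tree_pathP x u.
(* The path from [x] to [u] read backwards, without its new origin [u]. *)
have := @gdist_le u x (rev (belast x (tree_path x u))).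
rewrite size_rev size_belast; apply.
  by rewrite -{1}pu rev_path (eq_path (e' := @adj K))// => c d; rewrite adj_sym.
move: pu xp; case/lastP: (tree_path x u) => [//|s y]; rewrite last_rcons => -> _.
by case: s => [|z s]; rewrite //= rev_cons last_rcons.
Qed.

(** The initial piece ending at [c] is simple, hence is the tree path to [c]; so the position of [c]
    is its distance from [v]. *)
Lemma mem_tree_path v w c : c \in v :: tree_path v w ->
  (gdist v c + gdist c w = gdist v w)%N /\ index c (v :: tree_path v w) = gdist v c.
Proof.
rewrite [in gdist v w]/gdist; have [] := tree_pathP v w.
move: (tree_path v w) => r + + + cr; case/splitPl: cr => p q pc.
rewrite cat_path last_cat pc => /andP[vp cq] qw uq.
have up : uniq (v :: p) by move: uq; rewrite -cat_cons cat_uniq => /andP[].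
have Ep := tree_path_eq vp pc up.
have gp : gdist v c = size p by rewrite /gdist -Ep.
split.
  have Er : p ++ q = tree_path v w.
    by apply: tree_path_eq; rewrite ?cat_path ?last_cat ?vp ?pc.
  apply/eqP; rewrite eqn_leq size_cat gp leq_add2l (gdist_le cq qw)/=.
  by have := gdist_triangle c v w; rewrite {1}/gdist -Er size_cat gp.
rewrite gp -cat_cons index_cat -{1 2}pc mem_last; exact: index_last.
Qed.

(** Shortening the concatenation of the two tree paths yields the tree path from [v] to [w], which
    is at least as long; so nothing was removed, and [c] is on it. *)
Lemma gdist_mem v w c : (gdist v c + gdist c w <= gdist v w)%N ->
  c \in v :: tree_path v w.
Proof.
move=> le; have [vc cv _] := tree_pathP v c; have [cw wc _] := tree_pathP c w.
set p := tree_path v c ++ tree_path c w.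
have vp : path (@adj K) v p by rewrite cat_path cv vc.
have pw : last v p = w by rewrite last_cat cv.
have up : uniq (v :: p).
  have [tv tw ut] := tree_pathP v w.
  case: (shortenP vp) pw => q vq uq qp qw.
  apply: (leq_size_uniq uq); last first.
    by move: le; rewrite /= size_cat (tree_path_eq vq qw uq).
  by move=> d; rewrite !inE => /predU1P[->|/qp ->]; rewrite ?eqxx ?orbT.
by rewrite -(tree_path_eq vp pw up) -{1}cv -cat_cons mem_cat mem_last.
Qed.

Lemma tree_path_adj v w i : (i < gdist v w)%N ->
  adj (nth v (v :: tree_path v w) i) (nth v (v :: tree_path v w) i.+1).
Proof. by have [/(pathP v) + _ _] := tree_pathP v w; apply. Qed.

(* Otherwise the walk a - v - z - w - b would join the ends of the edge {a, b}
   without using it. *)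
Lemma tree_path_tripod v w z a b : adj a b ->
  a \in v :: tree_path v w -> b \in v :: tree_path v w ->
  (gdist v a < gdist v b)%N ->
  (a \in v :: tree_path v z) && (b \in v :: tree_path v z) \/
  (a \in z :: tree_path z w) && (b \in z :: tree_path z w).
Proof.
move=> ab avw bvw lt.
have avoidP c d : ~~ ((a \in c :: tree_path c d) && (b \in c :: tree_path c d)) ->
    reachable (avoid a b) c d.
  have [cd dE _] := tree_pathP c d.
  by move=> n; exists (tree_path c d) => //; exact: path_avoid.
have [in1|n1] := boolP ((a \in v :: tree_path v z) && (b \in v :: tree_path v z)).
  by left.
have [in2|n2] := boolP ((a \in z :: tree_path z w) && (b \in z :: tree_path z w)).
  by right.
(* With [gdist v a < gdist v b], these equalities keep [b] off the path from [v] to [a], and [a] off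
   the path from [b] to [w]. *)
have [Ea _] := mem_tree_path avw; have [Eb _] := mem_tree_path bvw.
case: (bridge ab); apply: reachable_sym; first exact: avoid_sym.
apply: (@reachable_trans _ _ _ v).
  apply: reachable_sym; first exact: avoid_sym.
  apply: avoidP; rewrite negb_and; apply/orP; right; apply/negP => /mem_tree_path[].
  lia.
apply: reachable_trans (avoidP _ _ n1) _; apply: reachable_trans (avoidP _ _ n2) _.
apply: reachable_sym; first exact: avoid_sym.
apply: avoidP; rewrite negb_and; apply/orP; left; apply/negP => /mem_tree_path[].
lia.
Qed.

Variable R : realType.
Local Notation X := (realization R K).
Local Notation vtx := (@vertex R K).
Implicit Types (x y : X) (f : K -> R).

(** * Affine functions and the path metric *)

Definition affine_ext f x : R := \sum_(c <- sval (cid (coordP x))) x c * f c.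

(** In particular the value does not depend on the simplex that [cid] picks. *)
Lemma affine_ext_sum f x (s : seq K) : uniq s -> (forall c, c \notin s -> x c = 0) ->
  affine_ext f x = \sum_(c <- s) x c * f c.
Proof.
move=> us xs; rewrite /affine_ext; case: cid => r /= [sr _ xr _].
apply: sum_support => //; first exact: simplex_uniq.
  by move=> c /xr ->; rewrite mul0r.
by move=> c /xs ->; rewrite mul0r.
Qed.

Lemma affine_ext_vertex f v : affine_ext f (vtx v) = f v.
Proof.
rewrite (@affine_ext_sum _ _ [:: v])// => [|c /=].
  by rewrite big_seq1 /= eqxx mul1r.
by rewrite inE => /negbTE ->.
Qed.

Lemma affine_ext_edge f a b x : in_edge a b x ->
  affine_ext f x = x a * f a + x b * f b.
Proof.
case=> ab xab; rewrite (@affine_ext_sum _ _ [:: a; b])//=.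
  by rewrite big_cons big_seq1.
by rewrite inE adj_neq.
Qed.

Lemma edge_chain_trans (x y z : X) (l m : R) : edge_chain x y l -> edge_chain y z m ->
  edge_chain x z (l + m).
Proof.
elim=> [t|a b t t' u k abt abt' _ IH] zm; first by rewrite add0r.
by rewrite -addrA; apply: EdgeChainCons abt abt' (IH zm).
Qed.

Lemma edge_chain1 a b x y : in_edge a b x -> in_edge a b y ->
  edge_chain x y `|x a - y a|.
Proof. by move=> abx aby; rewrite -[`|_|]addr0; apply: EdgeChainCons abx aby _; left. Qed.

Lemma edge_chain_sym x y l : edge_chain x y l -> edge_chain y x l.
Proof.
elim=> [t|a b t t' u k abt abt' _ IH]; first by left.
by rewrite addrC distrC; apply: edge_chain_trans IH _; exact: edge_chain1 abt' abt.
Qed.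

Lemma path_dist_sym x y : path_dist x y = path_dist y x.
Proof.
by congr inf; apply/seteqP; split=> l; exact: edge_chain_sym.
Qed.

Lemma edge_chain_ge0 x y l : edge_chain x y l -> 0 <= l.
Proof. by elim=> // *; rewrite addr_ge0. Qed.

Lemma path_dist_le x y l : edge_chain x y l -> path_dist x y <= l.
Proof. by move=> xyl; apply: ge_inf => //; exists 0 => m /edge_chain_ge0. Qed.

(** Ensures that [path_dist] is a genuine infimum and not the default 0. *)
Lemma edge_chain_exists x y : exists l, edge_chain x y l.
Proof.
have to_vertex (z : X) : exists c l, edge_chain z (vtx c) l.
  have [[c ->]|[a [b abz]]] := realization_cases z; first by exists c, 0; left.
  by exists a, `|z a - vtx a a|; apply: (edge_chain1 abz); apply: vertex_in_edge; case: abz.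
have [c [l xc]] := to_vertex x; have [d [m yd]] := to_vertex y.
suff [k cd] : exists k, edge_chain (vtx c) (vtx d) k.
  exists (l + (k + m)); apply: edge_chain_trans xc _.
  exact: edge_chain_trans cd (edge_chain_sym yd).
have [p] := conn c d; elim: p c {xc} => [|a p IH] c /=.
  by move=> _ ->; exists 0; left.
case/andP=> ca ap pd; have [k Hk] := IH _ ap pd.
exists (`|vtx c c - vtx a c| + k); apply: edge_chain_trans Hk.
apply: (@edge_chain1 c a); first exact: vertex_in_edge.
by apply: in_edge_sym; apply: vertex_in_edge; rewrite adj_sym.
Qed.

(** The source of lower bounds on distances: the affine extension of such an [f] is 1-Lipschitz on
    each edge, and increments add up along a chain. *)
Lemma path_dist_ge f x y : (forall a b, adj a b -> `|f a - f b| <= 1) ->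
  affine_ext f y - affine_ext f x <= path_dist x y.
Proof.
move=> f1; apply: lb_le_inf => [|l].
  by have [l] := edge_chain_exists x y; exists l.
elim=> [t|a b t t' u k abt abt' _ IH]; first by rewrite subrr.
suff : affine_ext f t' - affine_ext f t <= `|t a - t' a| by lra.
rewrite (affine_ext_edge f abt) (affine_ext_edge f abt').
have := in_edge_sum abt; have := in_edge_sum abt' => E' E.
have -> : t' a * f a + t' b * f b - (t a * f a + t b * f b) =
    (t' a - t a) * (f a - f b).
  have -> : t' b = 1 - t' a by lra.
  have -> : t b = 1 - t a by lra.
  by rewrite !mulrBl !mulrBr !mul1r; lra.
apply: le_trans (ler_norm _) _; rewrite normrM distrC ler_piMr//.
exact: f1 abt.1.
Qed.

Lemma gdist_lip v a b : adj a b -> `|(gdist v a)%:R - (gdist v b)%:R : R| <= 1.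
Proof.
move=> ab; have := gdist_adj_le1 ab; have := gdist_triangle a v b.
have := gdist_triangle b v a; rewrite (gdist_sym b a).
rewrite ler_norml !lerBlDr -!(ler_nat R) !natrD => h1 h2 h3.
by apply/andP; split; lra.
Qed.

Definition height v x : R := affine_ext (fun c => (gdist v c)%:R) x.

Lemma height_vertex v c : height v (vtx c) = (gdist v c)%:R.
Proof. exact: affine_ext_vertex. Qed.

Lemma height_edge v a b x : in_edge a b x ->
  height v x = x a * (gdist v a)%:R + x b * (gdist v b)%:R.
Proof. exact: affine_ext_edge. Qed.

Lemma height_le_path_dist v x : height v x <= path_dist (vtx v) x.
Proof.
have := @path_dist_ge (fun c => (gdist v c)%:R) (vtx v) x (@gdist_lip v).
by rewrite affine_ext_vertex gdistxx subr0.
Qed.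

(** * Coordinates of the points of a simple path *)

Definition tent (r : R) : R := Num.max 0 (1 - `|r|).

Lemma tent_out r : 1 <= r \/ r <= -1 -> tent r = 0.
Proof.
rewrite /tent; case: (lerP 0 r) => r0; rewrite ?(ger0_norm r0) ?(ltr0_norm r0) => h;
  by case: (lerP 0) => h'; lra.
Qed.

Lemma tent_pos r : 0 <= r <= 1 -> tent r = 1 - r.
Proof.
by move=> /andP[r0 r1]; rewrite /tent ger0_norm//; case: (lerP 0) => h; lra.
Qed.

Lemma tent_neg r : -1 <= r <= 0 -> tent r = 1 + r.
Proof.
by move=> /andP[r1 r0]; rewrite /tent ler0_norm//; case: (lerP 0) => h; lra.
Qed.

Lemma tent_nat_neq (i j : nat) : i <> j -> tent (i%:R - j%:R) = 0.
Proof.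
move=> ij; apply: tent_out.
have [lt|lt] : (i.+1 <= j)%N \/ (j.+1 <= i)%N by lia.
  by right; move: lt; rewrite -(ler_nat R) -natr1; lra.
by left; move: lt; rewrite -(ler_nat R) -natr1; lra.
Qed.

(** Recasts membership as an inequality that extends affinely to all points through [height]. *)
Lemma on_tree_pathE v w c :
  (c \in v :: tree_path v w) = ((gdist v c)%:R + (gdist w c)%:R <= (gdist v w)%:R :> R).
Proof.
rewrite -natrD ler_nat [gdist w c]gdist_sym.
by apply/idP/idP => [/mem_tree_path[-> _]//|]; exact: gdist_mem.
Qed.

Lemma tree_path_level v w c d : c \in v :: tree_path v w -> d \in v :: tree_path v w ->
  gdist v c = gdist v d -> c = d.
Proof.
move=> cs ds; have [_ ci] := mem_tree_path cs; have [_ di] := mem_tree_path ds.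
by rewrite -ci -di => E; rewrite -(nth_index v cs) E nth_index.
Qed.

(** For [t] between 0 and [gdist v w], these are the barycentric coordinates of the point at
    distance [t] from [v] on the simple path to [w]. *)
Definition profile v w (t : R) c : R :=
  if c \in v :: tree_path v w then tent (t - (gdist v c)%:R) else 0.

Lemma profile_vertex v w a (t : R) :
  (gdist v a)%:R <= t -> (gdist w a)%:R <= (gdist v w)%:R - t ->
  (gdist v a)%:R = t /\ vtx a =1 profile v w t.
Proof.
move=> va wa; have as_ : a \in v :: tree_path v w by rewrite on_tree_pathE; lra.
have [] := mem_tree_path as_; rewrite (gdist_sym a w) => /(congr1 (fun k => k%:R : R)).
rewrite natrD => E _; have Et : (gdist v a)%:R = t by lra.
split=> // c; rewrite /profile /=.
have [->|ca] := eqVneq c a; first by rewrite as_ Et subrr tent_pos ?mulr1n; lra.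
case: ifPn => // cs; rewrite -Et tent_nat_neq// => /(tree_path_level as_ cs) ac.
by rewrite ac eqxx in ca.
Qed.

(** The height of [x] lies between the consecutive levels of [a] and [b]; every other path vertex
    has a level at least 1 away, where the tent vanishes. *)
Lemma profile_step v w a b x : in_edge a b x ->
  a \in v :: tree_path v w -> b \in v :: tree_path v w ->
  gdist v b = (gdist v a).+1 -> Defs.coord x =1 profile v w (height v x).
Proof.
move=> abx as_ bs Eb c; have x1 := in_edge_sum abx.
have := coord_ge0 x a; have := coord_ge0 x b => xb xa.
have -> : height v x = (gdist v a)%:R + x b.
  by rewrite (height_edge _ abx) Eb -natr1 mulrDr mulr1 addrA -mulrDl x1 mul1r.
rewrite /profile; have [->|ca] := eqVneq c a.
  by rewrite as_ tent_pos; lra.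
have [->|cb] := eqVneq c b.
  by rewrite bs Eb -natr1 tent_neg; lra.
rewrite abx.2; last by rewrite !inE negb_or ca.
case: ifPn => // cs; rewrite tent_out//.
have nca : gdist v c <> gdist v a.
  by move=> /(tree_path_level cs as_) E; rewrite E eqxx in ca.
have ncb : gdist v c <> gdist v b.
  by move=> /(tree_path_level cs bs) E; rewrite E eqxx in cb.
have [lt|lt] : ((gdist v c).+1 <= gdist v a)%N \/ ((gdist v b).+1 <= gdist v c)%N by lia.
  by left; move: lt; rewrite -(ler_nat R) -natr1; lra.
by right; move: lt; rewrite Eb -(ler_nat R) -!natr1; lra.
Qed.

Lemma profile_edge v w a b x (t : R) : in_edge a b x -> 0 < x a -> 0 < x b ->
  height v x <= t -> height w x <= (gdist v w)%:R - t ->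
  height v x = t /\ Defs.coord x =1 profile v w t.
Proof.
move=> abx xa xb; have x1 := in_edge_sum abx.
rewrite !(height_edge _ abx) => vx wx.
have tri c : (gdist v w)%:R <= (gdist v c)%:R + (gdist w c)%:R :> R.
  by rewrite -natrD ler_nat (gdist_sym w c) gdist_triangle.
(* [r c] is the extra length of a detour through [c]. It is nonnegative, and its mean with the
   positive weights [x a], [x b] is at most 0, so it vanishes at both ends: [a] and [b] are on the
   path. *)
pose r c : R := (gdist v c)%:R + (gdist w c)%:R - (gdist v w)%:R.
have r_ge0 c : 0 <= r c by rewrite subr_ge0 tri.
have ha : 0 <= x a * r a by rewrite mulr_ge0 // ltW.
have hb : 0 <= x b * r b by rewrite mulr_ge0 // ltW.
have hs : x a * r a + x b * r b =
    x a * (gdist v a)%:R + x b * (gdist v b)%:R +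
    (x a * (gdist w a)%:R + x b * (gdist w b)%:R) - (x a + x b) * (gdist v w)%:R.
  by rewrite /r !mulrBr !mulrDr mulrDl; lra.
rewrite x1 mul1r in hs.
have /eqP ra : x a * r a = 0 by lra.
have /eqP rb : x b * r b = 0 by lra.
have Ea : (gdist v a)%:R + (gdist w a)%:R = (gdist v w)%:R :> R.
  by apply/eqP; move: ra; rewrite mulf_eq0 gt_eqF//= subr_eq0.
have Eb : (gdist v b)%:R + (gdist w b)%:R = (gdist v w)%:R :> R.
  by apply/eqP; move: rb; rewrite mulf_eq0 gt_eqF//= subr_eq0.
have as_ : a \in v :: tree_path v w by rewrite on_tree_pathE Ea.
have bs : b \in v :: tree_path v w by rewrite on_tree_pathE Eb.
have Et : x a * (gdist v a)%:R + x b * (gdist v b)%:R = t.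
  have E : x a * (gdist v a)%:R + x b * (gdist v b)%:R + (x a * (gdist w a)%:R +
      x b * (gdist w b)%:R) = (gdist v w)%:R.
    transitivity (x a * ((gdist v a)%:R + (gdist w a)%:R) +
      x b * ((gdist v b)%:R + (gdist w b)%:R)); first by rewrite !mulrDr; lra.
    by rewrite Ea Eb -mulrDl x1 mul1r.
  lra.
split=> //.
have ab : a != b by exact: adj_neq abx.1.
have vab : gdist v a <> gdist v b.
  by move=> /(tree_path_level as_ bs) E; rewrite E eqxx in ab.
have lip : (gdist v a <= (gdist v b).+1)%N /\ (gdist v b <= (gdist v a).+1)%N.
  have := gdist_adj_le1 abx.1; have := gdist_triangle a v b.
  by have := gdist_triangle b v a; rewrite (gdist_sym b a); lia.
rewrite -Et -(height_edge v abx).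
have [Ei|Ei] : gdist v b = (gdist v a).+1 \/ gdist v a = (gdist v b).+1 by lia.
  exact: profile_step abx as_ bs Ei.
exact: profile_step (in_edge_sym abx) bs as_ Ei.
Qed.

(** The rigidity behind uniqueness: the two bounds determine every coordinate. Vertices are handled
    apart, since the detour argument needs both weights positive. *)
Lemma height_profile v w x (t : R) :
  height v x <= t -> height w x <= (gdist v w)%:R - t ->
  height v x = t /\ Defs.coord x =1 profile v w t.
Proof.
have vert c : height v (vtx c) <= t -> height w (vtx c) <= (gdist v w)%:R - t ->
    height v (vtx c) = t /\ Defs.coord (vtx c) =1 profile v w t.
  by rewrite !height_vertex; exact: profile_vertex.
have [[c ->]|[a [b abx]]] := realization_cases x; first exact: vert.
have x1 := in_edge_sum abx; have := coord_ge0 x a; have := coord_ge0 x b => xb xa.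
have [xa0|xa0] := eqVneq (x a) 0.
  by have -> : x = vtx b; [apply: (in_edge_vertex (in_edge_sym abx)); lra|exact: vert].
have [xb0|xb0] := eqVneq (x b) 0.
  by have -> : x = vtx a; [apply: (in_edge_vertex abx); lra|exact: vert].
by apply: (profile_edge abx); rewrite lt_neqAle eq_sym ?xa0 ?xb0.
Qed.

(** * The geodesic between two vertices *)

Definition tree_point v w (t : R) : X :=
  xget (vtx v) [set x | height v x <= t /\ height w x <= (gdist v w)%:R - t].

(** Since [tree_point] is defined by inequalities that every geodesic satisfies, this identifies the
    point of any geodesic at time [t]. *)
Lemma tree_point_eq v w x (t : R) :
  height v x <= t -> height w x <= (gdist v w)%:R - t -> tree_point v w t = x.
Proof.
move=> vx wx; apply: xget_unique => // y [vy wy]; apply: realization_eq => c.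
by rewrite (height_profile vx wx).2 (height_profile vy wy).2.
Qed.

Lemma tree_point0 v w : tree_point v w 0 = vtx v.
Proof. by apply: tree_point_eq; rewrite height_vertex ?gdistxx ?subr0 // gdist_sym. Qed.

Lemma tree_point_gdist v w : tree_point v w (gdist v w)%:R = vtx w.
Proof. by apply: tree_point_eq; rewrite height_vertex ?gdistxx ?subrr. Qed.

(** Existence: the point at parameter [t - i] of the edge from position [i] to position [i.+1] has
    the required heights. *)
Lemma tree_point_segment v w i (t : R) : (i < gdist v w)%N -> i%:R <= t <= i.+1%:R ->
  let a := nth v (v :: tree_path v w) i in
  let b := nth v (v :: tree_path v w) i.+1 in
  let x := tree_point v w t in
  [/\ in_edge a b x, x b = t - i%:R, height v x = t & height w x = (gdist v w)%:R - t].
Proof.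
move=> iw it a b x; have ab : adj a b := tree_path_adj iw.
have lvl j : (j <= gdist v w)%N -> let c := nth v (v :: tree_path v w) j in
    gdist v c = j /\ (gdist v c + gdist w c = gdist v w)%N.
  move=> jw c; have cs : c \in v :: tree_path v w by rewrite mem_nth.
  have [Ec <-] := mem_tree_path cs; rewrite (gdist_sym w c).
  have ic : index c (v :: tree_path v w) = j.
    by rewrite index_uniq//; have [] := tree_pathP v w.
  by split=> //; rewrite {1}ic -Ec; congr addn; rewrite -ic (mem_tree_path cs).2.
have [va Ea] := lvl _ (ltnW iw); have [vb Eb] := lvl _ iw.
have t01 : 0 <= t - i%:R <= 1 by move: it; rewrite -natr1; lra.
pose y := edge_point ab (t - i%:R).
have aby : in_edge a b y by exact: edge_point_in.
have yb : y b = t - i%:R by rewrite edge_point_tgt clamp_id.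
have ya : y a = 1 - (t - i%:R) by rewrite edge_point_src clamp_id.
have hv : height v y = t.
  by rewrite (height_edge _ aby) va vb ya yb -[i.+1%:R]natr1; lra.
have hw : height w y = (gdist v w)%:R - t.
  have {}Ea : (gdist w a)%:R = (gdist v w)%:R - i%:R :> R.
    by rewrite -Ea natrD va; lra.
  have {}Eb : (gdist w b)%:R = (gdist v w)%:R - i.+1%:R :> R.
    by rewrite -Eb natrD vb; lra.
  by rewrite (height_edge _ aby) Ea Eb ya yb -[i.+1%:R]natr1; lra.
suff -> : x = y by [].
by apply: tree_point_eq; rewrite ?hv ?hw.
Qed.

Lemma segment_index (n : nat) (t : R) : (0 < n)%N -> 0 <= t <= n%:R ->
  exists2 i, (i < n)%N & i%:R <= t <= i.+1%:R.
Proof.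
elim: n => // -[|n] IH _ t0n; first by exists 0%N.
have [tn|nt] := lerP t n.+1%:R.
  by have [i lt it] := IH isT (introT andP (conj (proj1 (andP t0n)) tn));
    exists i => //; exact: ltnW.
by exists n.+1 => //; rewrite (ltW nt) (andP t0n).2.
Qed.

Lemma height_tree_point v w (t : R) : 0 <= t <= (gdist v w)%:R ->
  height v (tree_point v w t) = t /\
  height w (tree_point v w t) = (gdist v w)%:R - t.
Proof.
move=> t0n; have [n0|n_gt0] := posnP (gdist v w).
  have -> : t = 0 by rewrite n0 in t0n; lra.
  by rewrite tree_point0 !height_vertex gdistxx gdist_sym subr0.
by have [i iw /(tree_point_segment iw)[]] := segment_index n_gt0 t0n.
Qed.

(** Induction on the bound [m], cutting the segment at the last integer level; inside one edge the
    chain is a single step. *)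
Lemma edge_chain_tree_point v w (m : nat) (s t : R) : (m <= gdist v w)%N ->
  0 <= s -> s <= t -> t <= m%:R ->
  edge_chain (tree_point v w s) (tree_point v w t) (t - s).
Proof.
elim: m s t => [|m IH] s t mw s0 st tm.
  by have [-> ->] : s = 0 /\ t = 0 by [split; lra]; rewrite subrr; left.
have local r : m%:R <= r -> r <= t ->
    edge_chain (tree_point v w r) (tree_point v w t) (t - r).
  move=> mr rt.
  have [|e1 c1 _ _] := @tree_point_segment v w m r mw; first by lra.
  have [|e2 c2 _ _] := @tree_point_segment v w m t mw; first by lra.
  have := edge_chain1 (in_edge_sym e1) (in_edge_sym e2).
  rewrite c1 c2 distrC ger0_norm; last by lra.
  by congr edge_chain; lra.
have [tm'|mt] := lerP t m%:R; first by apply: IH => //; exact: ltnW.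
have [ms|sm] := lerP m%:R s; first exact: local.
have -> : t - s = (m%:R - s) + (t - m%:R) by lra.
apply: (edge_chain_trans (y := tree_point v w m%:R)).
  by apply: IH => //; [exact: ltnW|exact: ltW].
by apply: local => //; exact: ltW.
Qed.

(** The chain along the path bounds the distance from above, the 1-Lipschitz function [height v]
    from below. *)
Lemma path_dist_tree_point v w (s t : R) :
  0 <= s <= (gdist v w)%:R -> 0 <= t <= (gdist v w)%:R ->
  path_dist (tree_point v w s) (tree_point v w t) = `|s - t|.
Proof.
move=> s0n t0n; wlog st : s t s0n t0n / s <= t.
  move=> H; have [st|ts] := orP (le_total s t); first exact: H.
  by rewrite path_dist_sym distrC; exact: H.
have /andP[t0 tn] := t0n; have /andP[s0 sn] := s0n.
apply/eqP; rewrite eq_le distrC ger0_norm ?subr_ge0//; apply/andP; split.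
  by apply: path_dist_le; exact: (edge_chain_tree_point (leqnn _)).
have := path_dist_ge (tree_point v w s) (tree_point v w t) (@gdist_lip v).
rewrite -![affine_ext _ _]/(height v _).
by rewrite (height_tree_point s0n).1 (height_tree_point t0n).1.
Qed.

Lemma path_dist_vertex v w : path_dist (vtx v) (vtx w) = (gdist v w)%:R.
Proof.
rewrite -{1}(tree_point0 v w) -{1}(tree_point_gdist v w) path_dist_tree_point.
- by rewrite distrC subr0 ger0_norm.
- by rewrite lexx ler0n.
- by rewrite lexx ler0n.
Qed.

Definition tree_geodesic_map v w (t : geo_dom (vtx v) (vtx w)) : X :=
  tree_point v w (val t).

Lemma geo_dom_bounds v w (t : geo_dom (vtx v) (vtx w)) :
  0 <= val t <= (gdist v w)%:R.
Proof. by rewrite -path_dist_vertex; exact: (valP t). Qed.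

Fact tree_geodesic_isometry v w (s t : geo_dom (vtx v) (vtx w)) :
  path_dist (tree_geodesic_map s) (tree_geodesic_map t) = `|val s - val t|.
Proof. by apply: path_dist_tree_point; exact: geo_dom_bounds. Qed.

Fact tree_geodesic_src v w : tree_geodesic_map (geo_src (vtx v) (vtx w)) = vtx v.
Proof. exact: tree_point0. Qed.

Fact tree_geodesic_tgt v w : tree_geodesic_map (geo_tgt (vtx v) (vtx w)) = vtx w.
Proof. by rewrite /tree_geodesic_map /= path_dist_vertex tree_point_gdist. Qed.

Definition tree_geodesic v w : geodesic (vtx v) (vtx w) :=
  Geodesic (@tree_geodesic_isometry v w) (tree_geodesic_src v w) (tree_geodesic_tgt v w).

(** By isometry [g t] is at distance [val t] from [v] and [gdist v w - val t] from [w]; heights are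
    at most distances. *)
Lemma geodesic_height v w (g : geodesic (vtx v) (vtx w)) t :
  height v (g t) <= val t /\ height w (g t) <= (gdist v w)%:R - val t.
Proof.
have /andP[t0 tn] := geo_dom_bounds t; split.
  apply: le_trans (height_le_path_dist _ _) _.
  by rewrite -{1}(gmap_src g) gmap_isometry /= distrC subr0 ger0_norm.
apply: le_trans (height_le_path_dist _ _) _.
rewrite -{1}(gmap_tgt g) gmap_isometry /= ger0_norm.
  by rewrite lerD2r path_dist_vertex.
by rewrite subr_ge0; case/andP: (valP t).
Qed.

Lemma tree_geodesic_unique v w (g : geodesic (vtx v) (vtx w)) : g = tree_geodesic v w.
Proof.
have : gmap g = gmap (tree_geodesic v w).
  apply/funext => t; have [gv gw] := geodesic_height g t.
  by rewrite /= /tree_geodesic_map (tree_point_eq gv gw).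
case: g => f fi fs ft; rewrite /tree_geodesic /= => E.
by move: fi fs ft; rewrite E => *; congr Geodesic; exact: Prop_irrelevance.
Qed.

(** * Images of geodesics *)

Lemma height_ge0 v x : 0 <= height v x.
Proof. by apply: sumr_ge0 => c _; rewrite mulr_ge0// coord_ge0. Qed.

(** A point satisfying the inequality is the one visited at time [height v x]. *)
Lemma im_tree_geodesic v w x :
  im (tree_geodesic v w) x <-> height v x + height w x <= (gdist v w)%:R.
Proof.
split=> [[t _ <-]|xvw].
  by have [h1 h2] := geodesic_height (tree_geodesic v w) t; lra.
have dom : 0 <= height v x <= path_dist (vtx v) (vtx w).
  by rewrite path_dist_vertex height_ge0; have := height_ge0 w x; lra.
exists (exist _ (height v x) dom) => //=.
by rewrite /tree_geodesic_map /=; apply: tree_point_eq => //; lra.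
Qed.

Lemma im_tree_geodesic_vertex v w c :
  im (tree_geodesic v w) (vtx c) <-> c \in v :: tree_path v w.
Proof.
rewrite on_tree_pathE; split; first by move=> /im_tree_geodesic; rewrite !height_vertex.
by move=> ?; apply/im_tree_geodesic; rewrite !height_vertex.
Qed.

(** The criterion of [im_tree_geodesic] is affine along the edge, so it passes from the two ends to
    the whole edge. *)
Lemma im_tree_geodesic_edge v w a b x : in_edge a b x ->
  a \in v :: tree_path v w -> b \in v :: tree_path v w -> im (tree_geodesic v w) x.
Proof.
rewrite !on_tree_pathE => abx va vb; apply/im_tree_geodesic.
rewrite !(height_edge _ abx).
have ha : x a * ((gdist v a)%:R + (gdist w a)%:R) <= x a * (gdist v w)%:R.
  by rewrite ler_wpM2l ?coord_ge0.
have hb : x b * ((gdist v b)%:R + (gdist w b)%:R) <= x b * (gdist v w)%:R.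
  by rewrite ler_wpM2l ?coord_ge0.
have : (x a + x b) * (gdist v w)%:R = (gdist v w)%:R by rewrite (in_edge_sum abx) mul1r.
by move: ha hb; rewrite !mulrDr mulrDl; lra.
Qed.

(** A point of the image lies on an edge of the path, and [tree_path_tripod] puts both ends of that
    edge on one of the other two paths. *)
Lemma im_tree_geodesic_tripod v w z :
  im (tree_geodesic v w) `<=` im (tree_geodesic v z) `|` im (tree_geodesic z w).
Proof.
move=> _ [t _ <-]; rewrite /= /tree_geodesic_map; have t0n := geo_dom_bounds t.
move: {t} (val t) t0n => t t0n; have [n0|n_gt0] := posnP (gdist v w).
  have -> : t = 0 by rewrite n0 in t0n; lra.
  by rewrite tree_point0; left; apply/im_tree_geodesic_vertex; exact: mem_head.
have [i iw /(tree_point_segment iw)[abx _ _ _]] := segment_index n_gt0 t0n.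
move: abx; set a := nth v _ i; set b := nth v _ i.+1; set x := tree_point v w t => abx.
have as_ : a \in v :: tree_path v w by rewrite mem_nth//= ltnS ltnW.
have bs : b \in v :: tree_path v w by rewrite mem_nth.
have lt : (gdist v a < gdist v b)%N.
  have [_ _ us] := tree_pathP v w.
  have [_ <-] := mem_tree_path as_; have [_ <-] := mem_tree_path bs.
  by rewrite !index_uniq//= ltnS ltnW.
have [/andP[]|/andP[]] := tree_path_tripod z abx.1 as_ bs lt => az bz; [left|right];
  exact: im_tree_geodesic_edge abx az bz.
Qed.

(** Induction on [n], splitting the geodesic at the last but one vertex. *)
Lemma im_tree_geodesic_polygon (n : nat) (v : nat -> K) : (2 <= n)%N ->
  im (tree_geodesic (v 1%N) (v n)) `<=`
    \bigcup_(i in [set i | (1 <= i < n)%N]) im (tree_geodesic (v i) (v i.+1)).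
Proof.
elim: n => // n IH; rewrite ltnS leq_eqVlt => /predU1P[<-|n2] x.
  by exists 1%N.
move=> /(@im_tree_geodesic_tripod _ _ (v n))[/(IH n2)[i /= i1n xi]|xn].
  by exists i => //=; case/andP: i1n => -> /ltnW.
by exists n => //=; rewrite ltnSn ltnW.
Qed.

(** * The correspondence between geodesics and simple paths *)

Fact tree_path_simple v w :
  [&& v :: tree_path v w != [::], sorted (@adj K) (v :: tree_path v w)
    & uniq (v :: tree_path v w)].
Proof. by have [/= -> _ ->] := tree_pathP v w. Qed.

Definition geodesic_path (g : vertex_geodesic R K) : simple_path K :=
  exist _ (vg_src g :: tree_path (vg_src g) (vg_tgt g)) (tree_path_simple _ _).

Lemma geodesic_path_bij : bijective geodesic_path.
Proof.
have surj s : exists g, geodesic_path g = s.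
  case: s => -[|v p] //= vp; exists (VertexGeodesic (tree_geodesic v (last v p))).
  apply: val_inj => /=; case/andP: (vp) => vp' up.
  by rewrite -(tree_path_eq vp' erefl up).
(* The first and last entries of the sequence recover the endpoints, and geodesics with given
   endpoints are unique. *)
have inj : injective geodesic_path.
  case=> v w g [v' w' g'] /(congr1 val) /= [vv].
  have [_ Ew _] := tree_pathP v w; have [_ Ew' _] := tree_pathP v' w'.
  rewrite -{v'}vv in g' Ew' * => E; rewrite E Ew' in Ew; rewrite -{w}Ew in g E *.
  by rewrite (tree_geodesic_unique g) (tree_geodesic_unique g').
have [h hK] := choice surj; exists h => // g.
by apply: inj; rewrite hK.
Qed.

(** The geodesic reaches each vertex of the path at a time equal to the position of that vertex in
    the sequence. *)
Lemma geodesic_path_traverses g : traverses g (val (geodesic_path g)).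
Proof.
case: g => v w g /=; rewrite (tree_geodesic_unique g) {g} /traverses /=.
split=> [c|t t' c c' tc tc'].
  by split=> /im_tree_geodesic_vertex.
have level (r : geo_dom (vtx v) (vtx w)) d : tree_geodesic_map r = vtx d ->
    val r = (index d (v :: tree_path v w))%:R.
  move=> rd; have dP : d \in v :: tree_path v w.
    by apply/im_tree_geodesic_vertex; exists r.
  have [_ ->] := mem_tree_path dP; rewrite -height_vertex -rd.
  by rewrite (height_tree_point (geo_dom_bounds r)).1.
by rewrite (level _ _ tc) (level _ _ tc') ler_nat.
Qed.

End TreePaths.

(** [traverses] makes the bijection the natural one, and the uniqueness clause identifies [u v w] as
    the only geodesic from [v] to [w]. *)
Theorem proposition8p4 (R : realType) (T : complex1)
    (tree : geometric_tree R T) (lfT : locally_finite T) :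
  (exists phi : vertex_geodesic R T -> simple_path T,
     bijective phi /\ forall g, traverses g (val (phi g))) /\
  (exists u : forall v w : T, geodesic (vertex R v) (vertex R w),
     (forall v w (g : geodesic (vertex R v) (vertex R w)), g = u v w) /\
     forall (n : nat) (v : nat -> T), (2 <= n)%N ->
       im (u (v 1%N) (v n)) `<=`
         \bigcup_(i in [set i | (1 <= i < n)%N]) im (u (v i) (v i.+1))).
Proof.
have conn := contractible_reachable tree.
have bridge (a b : T) (ab : adj a b) := contractible_bridge ab tree.
split.
  exists (@geodesic_path T conn R); split.
    exact: geodesic_path_bij.
  exact: geodesic_path_traverses.
exists (tree_geodesic conn bridge R); split.
  exact: tree_geodesic_unique.
exact: im_tree_geodesic_polygon.
Qed.
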